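(* There is an absolute constant $C$ such that for every monotone path $\mathcal{P}$ in a binary tree with $k$ nodes, the change $\Delta\Phi$ of the potential caused by applying the multipass transformation to $\mathcal{P}$ satisfies $$\Delta\Phi \le -\frac{k}{2^{\log^{\ast} n}} + C\log n\cdot \log^{\ast} n,$$ where $n$ is the size of the subtree rooted at the topmost node of $\mathcal{P}$.
   Context: All logarithms are base 2; $\log^{\ast}$ is the iterated logarithm. For a binary tree $T$ and a non-root node $x$ with parent $p(x)$, let $s(\cdot)$ denote subtree size, $H(x)=\log\frac{s(p(x))}{s(x)}$, $\phi(x)=\frac{H(x)}{\log^2(2+H(x))}$, and $\Phi(T)=\sum_x\phi(x)$ over all non-root nodes. A monotone path is a downward path consisting only of right-child pointers (the left-child case is symmetric); its lowest node need not be a leaf. The multipass transformation of a monotone path $\mathcal{P}$ of length $\ell(\mathcal{P})$ (number of nodes) proceeds in pairing rounds; in each round every other edge in a prefix (topmost part) of the current path is rotated, i.e. the edges between its 1st and 2nd, 3rd and 4th, ... nodes, each rotation pushing one node off the path. Let $\mathcal{P}^i$ be the path remaining after $i$ rounds. Round 1 performs $\alpha$ rotations where $\alpha$ is the smallest nonnegative integer with $\ell(\mathcal{P})-\alpha=2^j-1$ for some integer $j$; round $i>1$ performs $2^{j-i+1}-1$ rotations on $\mathcal{P}^{i-1}$; this continues until the path has a single node, yielding a balanced tree.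
   Formalization: Each missing child is taken to be an external leaf node, and these leaves count in the subtree sizes s, in the potential Φ and in n; if only the ordinary nodes counted, the claim would fail for a bare path of 2^j − 1 nodes. *)

(* Defs.v *)
From Stdlib Require Import Reals Lra Lia Arith List Bool.
Import ListNotations.
Open Scope R_scope.

(** Extended binary trees: every node carrying a key is a [Node] with exactly
    two children, and an absent child is the external node [Leaf].  External
    nodes are nodes of the tree: they count in [size] and in [Phi].  This
    matters.  If only the keyed nodes were counted, balancing a bare path of
    [n = 2^j - 1] nodes would raise the potential from at most [lg n] to at
    least [0.39 * (n - 1)].  Keys play no role. *)
Inductive bintree : Type :=
| Leaf : bintree
| Node : bintree -> bintree -> bintree.

Inductive side : Type := ToLeft | ToRight.

Fixpoint size (t : bintree) : nat :=
  match t with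
  | Leaf => 1
  | Node l r => S (size l + size r)
  end.

Definition lg (x : R) : R := ln x / ln 2.

(** [edge_H p c] is H(x) for a node [x] of subtree size [c] whose parent has
    subtree size [p]. *)
Definition edge_H (p c : nat) : R := lg (INR p / INR c).

Definition phi (p c : nat) : R := edge_H p c / (lg (2 + edge_H p c)) ^ 2.

Fixpoint Phi (t : bintree) : R :=
  match t with
  | Leaf => 0
  | Node l r => phi (size t) (size l) + phi (size t) (size r) + Phi l + Phi r
  end.

Fixpoint lg_iter (i : nat) (x : R) : R :=
  match i with
  | O => x
  | S i' => lg_iter i' (lg x)
  end.

Fixpoint log_star_fuel (fuel : nat) (x : R) : nat :=
  match fuel with
  | O => 0
  | S f => if Rle_dec x 1 then 0 else S (log_star_fuel f (lg x))
  end.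

(** The fuel [n] always suffices, see [log_star_spec]. *)
Definition log_star (n : nat) : nat := log_star_fuel n (INR n).

Definition child (d : side) (t : bintree) : bintree :=
  match t with
  | Leaf => Leaf
  | Node l r => match d with ToLeft => l | ToRight => r end
  end.

Definition set_child (d : side) (t u : bintree) : bintree :=
  match t with
  | Leaf => Leaf
  | Node l r => match d with ToLeft => Node u r | ToRight => Node l u end
  end.

(** A node is addressed by the list of sides taken from the root.  Addresses
    running past an external node yield [Leaf], so a subtree of the form
    [Node _ _] is always at a genuine address. *)
Fixpoint subtree (t : bintree) (a : list side) : bintree :=
  match a with
  | [] => t
  | d :: a' => subtree (child d t) a'
  end.

Fixpoint replace_at (t : bintree) (a : list side) (u : bintree) : bintree :=
  match a with
  | [] => u
  | d :: a' => set_child d t (replace_at (child d t) a' u)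
  end.

(** The [k] path nodes are at the addresses [a], [a ++ [d]], ...,
    [a ++ repeat d (k - 1)]; the last of them must be a keyed node, which makes
    all of them keyed nodes. *)
Definition monotone_path (t : bintree) (d : side) (a : list side) (k : nat)
  : Prop :=
  (1 <= k)%nat /\ subtree t (a ++ repeat d (k - 1)) <> Leaf.

(** Rotation of the edge between the root and its [d]-child. *)
Definition rotate (d : side) (t : bintree) : bintree :=
  match d, t with
  | ToRight, Node A (Node B C) => Node (Node A B) C
  | ToLeft, Node (Node C B) A => Node C (Node B A)
  | _, _ => t
  end.

(** Rotates the edges between the 1st and 2nd, 3rd and 4th, ..., [2m-1]-st and
    [2m]-th nodes of the [d]-path starting at the root.  After a rotation the
    next unpaired path node is the [d]-child of the new root. *)
Fixpoint pairing_round (d : side) (m : nat) (t : bintree) : bintree :=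
  match m with
  | O => t
  | S m' => let t' := rotate d t in
            set_child d t' (pairing_round d m' (child d t'))
  end.

(** The exponent [j] and the number [alpha] of rotations in the first round for
    a path of [k] nodes; see [first_round_spec]. *)
Definition top_exp (k : nat) : nat := Nat.log2 (k + 1).
Definition alpha (k : nat) : nat := k - (2 ^ top_exp k - 1).

(** Acts on the subtree rooted at the topmost of the [k] path nodes.  Round [i],
    for [i = 2, ..., j], performs [2^(j-i+1) - 1] rotations; the formula gives
    no rotation for [i = j + 1].  Before round [i >= 2] the [d]-path has
    [2^(j-i+2) + i - 3] nodes left: all but the first [2^(j-i+2) - 1] are already
    in their final place and form the lower part of the [d]-spine of the balanced
    tree, so that exactly one node remains to be paired after round [j].  In
    particular no round reaches below the [k]-th node. *)
Definition multipass (d : side) (k : nat) (t : bintree) : bintree :=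
  let j := top_exp k in
  fold_left (fun u i => pairing_round d (2 ^ (j - i + 1) - 1) u)
            (seq 2 (j - 1))
            (pairing_round d (alpha k) t).

Lemma first_round_spec (k : nat) :
  (alpha k <= k /\ k - alpha k = 2 ^ top_exp k - 1)%nat /\
  (forall a j : nat, (a <= k)%nat -> (k - a = 2 ^ j - 1)%nat ->
     (alpha k <= a)%nat).
Proof.
unfold alpha, top_exp.
destruct (Nat.log2_spec (k + 1)) as [h1 h2]; [lia|].
split; [lia|].
intros a j ha hj.
assert (hp : (2 ^ j <> 0)%nat) by (apply Nat.pow_nonzero; lia).
assert (hj' : (j <= Nat.log2 (k + 1))%nat).
{ apply Nat.log2_le_pow2; lia. }
apply (Nat.pow_le_mono_r 2) in hj'; lia.
Qed.

Lemma lg_le_pred (x : R) : 2 <= x -> lg x <= x - 1.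
Proof.
intros hx.
assert (hl : / 2 < ln 2) by apply ln_lt_2.
assert (e : ln x = ln 2 + ln (x / 2)).
{ rewrite <- ln_mult by lra. f_equal. field. }
assert (hb : ln (x / 2) <= x / 2 - 1).
{ pose proof (exp_ineq1_le (ln (x / 2))) as h.
  rewrite exp_ln in h by lra. lra. }
unfold lg. apply Rmult_le_reg_r with (ln 2); [lra|].
unfold Rdiv. rewrite Rmult_assoc, Rinv_l by lra. nra.
Qed.

Lemma log_star_fuel_spec (f : nat) (x : R) : x <= INR f -> (1 <= f)%nat ->
  lg_iter (log_star_fuel f x) x <= 1 /\
  forall i : nat, (i < log_star_fuel f x)%nat -> 1 < lg_iter i x.
Proof.
revert x; induction f as [|f IH]; intros x hx hf; [lia|].
cbn [log_star_fuel]. destruct (Rle_dec x 1) as [h|h].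
{ split; [exact h | lia]. }
assert (hf1 : (1 <= f)%nat).
{ destruct f; [simpl in hx; lra | lia]. }
assert (hlx : lg x <= INR f).
{ rewrite S_INR in hx. destruct (Rle_lt_dec 2 x) as [h2|h2].
  - pose proof (lg_le_pred x h2). lra.
  - assert (1 <= INR f) by (apply (le_INR 1); lia).
    assert (hl : / 2 < ln 2) by apply ln_lt_2.
    assert (ln x < ln 2) by (apply ln_increasing; lra).
    enough (lg x <= 1) by lra.
    unfold lg. apply Rmult_le_reg_r with (ln 2); [lra|].
    unfold Rdiv. rewrite Rmult_assoc, Rinv_l by lra. lra. }
destruct (IH (lg x) hlx hf1) as [i1 i2].
split; [exact i1|].
intros [|i] hi; simpl; [lra | apply i2; lia].
Qed.

Lemma log_star_spec (n : nat) : (1 <= n)%nat ->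
  lg_iter (log_star n) (INR n) <= 1 /\
  forall i : nat, (i < log_star n)%nat -> 1 < lg_iter i (INR n).
Proof. intros h. apply log_star_fuel_spec; [apply Rle_refl | exact h]. Qed.

(* Main.v *)
Require Import Defs.
From Stdlib Require Import Reals List Lra Lia Arith.
From Coquelicot Require Import Coquelicot.
Import ListNotations.
Open Scope R_scope.

(** Consider the rotation of two consecutive path nodes with off-path subtrees
    of sizes [a] and [b], where [S] is the size at the upper node, [c] the size
    below the lower node and [D = 1 + a + b]; put [f x = x / lg (2 + x) ^ 2].
    It raises the potential by at most [O (lg (S / c))], and these terms
    telescope along the path, so a round loses at most [O (lg n)].  If moreover
    [y = lg (S / D)] is large, the potential drops by about [y * f' x], where
    [x] is the larger of [lg (S / a)] and [lg (S / b)].  Hence either the drop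
    exceeds a given constant or [y = O (lg x ^ 2)].  Give a path node a credit
    of 3 once [H] of its off-path child exceeds a level that starts at [n ^ 3]
    and, from round to round, passes from [z ^ 3] to [(lg z) ^ 3]; the credits
    are paid by the drops.  After [L = log_star n] rounds the level is a constant, and
    a path node without credit has a path child smaller by a constant factor,
    so there are only [O (lg n)] of those.  Thus [L] rounds that leave [m] path
    nodes gain [3 * m - O (lg n * L)].  This exceeds the losses as long as [m]
    is at least of order [lg n * L], after which [O (L)] rounds bring the path
    down to length [lg n], and the remaining losses form a convergent series. *)


(** * Elementary estimates for logarithms *)

Lemma ln_ge_one_sub_inv (x : R) : 0 < x -> 1 - / x <= ln x.
Proof.
intros hx.
pose proof (exp_ineq1_le (ln (/ x))) as h.
rewrite exp_ln in h by now apply Rinv_0_lt_compat.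
rewrite ln_Rinv in h by assumption. lra.
Qed.

Lemma ln_le_sub_one (x : R) : 0 < x -> ln x <= x - 1.
Proof.
intros hx. pose proof (exp_ineq1_le (ln x)) as h.
rewrite exp_ln in h by assumption. lra.
Qed.

Lemma ln2_bounds : 7 / 12 <= ln 2 < 1.
Proof.
split.
- replace 2 with (4 / 3 * (3 / 2)) by field.
  rewrite ln_mult by lra.
  pose proof (ln_ge_one_sub_inv (4 / 3)).
  pose proof (ln_ge_one_sub_inv (3 / 2)). lra.
- pose proof (ln_increasing 2 (exp 1)) as h. rewrite ln_exp in h.
  apply h; [lra|]. pose proof (exp_ineq1 1). lra.
Qed.

Lemma lg_2 : lg 2 = 1.
Proof. unfold lg. field. pose proof ln2_bounds. lra. Qed.

Lemma lg_le (x y : R) : 0 < x -> x <= y -> lg x <= lg y.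
Proof.
intros hx hxy. pose proof ln2_bounds as hl. unfold lg.
apply Rmult_le_compat_r; [left; apply Rinv_0_lt_compat; lra|].
now apply ln_le.
Qed.

Lemma lg_nonneg (x : R) : 1 <= x -> 0 <= lg x.
Proof.
intros hx. replace 0 with (lg 1); [apply lg_le; lra|].
unfold lg. rewrite ln_1. field. pose proof ln2_bounds. lra.
Qed.

Lemma lg_ge_1 (x : R) : 2 <= x -> 1 <= lg x.
Proof. intros hx. rewrite <- lg_2. apply lg_le; lra. Qed.

Lemma lg_mult (x y : R) : 0 < x -> 0 < y -> lg (x * y) = lg x + lg y.
Proof.
intros hx hy. unfold lg. rewrite ln_mult by assumption.
field. pose proof ln2_bounds. lra.
Qed.

Lemma lg_pow (x : R) (m : nat) : 0 < x -> lg (x ^ m) = INR m * lg x.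
Proof.
intros hx. unfold lg. rewrite ln_pow by assumption.
field. pose proof ln2_bounds. lra.
Qed.

Lemma lg_div_trans (x y z : R) :
  0 < x -> 0 < y -> 0 < z -> lg (x / y) + lg (y / z) = lg (x / z).
Proof.
intros hx hy hz. rewrite <- lg_mult by now apply Rdiv_lt_0_compat.
f_equal. field. lra.
Qed.

Lemma lg_div_nonneg (x y : R) : 0 < y -> y <= x -> 0 <= lg (x / y).
Proof.
intros hy hxy. apply lg_nonneg. apply Rmult_le_reg_r with y; [easy|].
unfold Rdiv. rewrite Rmult_assoc, Rinv_l; lra.
Qed.

Lemma ln_lg (x : R) : ln x = lg x * ln 2.
Proof. unfold lg. field. pose proof ln2_bounds. lra. Qed.

Lemma lg_le_twice_ln (x : R) : 1 <= x -> lg x <= 2 * ln x.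
Proof.
intros hx. pose proof (lg_nonneg x hx). rewrite ln_lg.
pose proof ln2_bounds. nra.
Qed.

Lemma ln_le_lg (x : R) : 1 <= x -> ln x <= lg x.
Proof.
intros hx. pose proof (lg_nonneg x hx). rewrite ln_lg.
pose proof ln2_bounds. nra.
Qed.

Lemma lg_le_self (x : R) : 1 <= x -> lg x <= x.
Proof.
intros hx. destruct (Rle_lt_dec 2 x) as [h|h].
- pose proof (lg_le_pred x h). lra.
- pose proof (lg_le x 2). rewrite lg_2 in H. lra.
Qed.

(** Both [D] and [c] fit below [S], so a large share of [D] forces [S / c] away
    from [1]. *)
Lemma lg_div_lower_bound (S D c y : R) :
  0 < D -> 0 < c -> D + c <= S -> lg (S / D) <= y ->
  exp (- y) <= lg (S / c).
Proof.
intros hD hc hS hy.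
assert (h1 : 1 <= S / c).
{ apply Rmult_le_reg_r with c; [easy|]. unfold Rdiv.
  rewrite Rmult_assoc, Rinv_l; lra. }
assert (h1' : 1 <= S / D).
{ apply Rmult_le_reg_r with D; [easy|]. unfold Rdiv.
  rewrite Rmult_assoc, Rinv_l; lra. }
apply Rle_trans with (ln (S / c)); [|now apply ln_le_lg].
apply Rle_trans with (D / S).
- replace (D / S) with (exp (- ln (S / D))).
  + pose proof (ln_le_lg _ h1').
    destruct (Rle_lt_or_eq_dec (- y) (- ln (S / D))) as [h|h]; [lra| |].
    * left. now apply exp_increasing.
    * rewrite h. lra.
  + rewrite exp_Ropp, exp_ln by lra. field. lra.
- pose proof (ln_ge_one_sub_inv (S / c)) as h.
  assert (e : 1 - / (S / c) = (S - c) / S) by (field; lra).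
  rewrite e in h. apply Rle_trans with ((S - c) / S); [|lra].
  apply Rmult_le_compat_r; [left; apply Rinv_0_lt_compat; lra|lra].
Qed.

(** With [s] the fourth root of [2 + y], [ln (2 + y) = 4 * ln s] makes [lg (2 + y)] at most [8 * s],
    so its square is at most [64 * sqrt (2 + y)]. *)
Lemma lg_sq_sublinear (A : R) : 0 < A ->
  exists Y : R, 1 <= Y /\ forall y : R, Y <= y -> A * lg (2 + y) ^ 2 <= y.
Proof.
(* [2] gives [2 + y <= 2 * y]; the other bound gives [(64 * A) ^ 2 * (2 * y) <= y ^ 2]. *)
intros hA. exists (Rmax 2 (2 * (64 * A) ^ 2)).
split; [pose proof (Rmax_l 2 (2 * (64 * A) ^ 2)); lra|].
intros y hy.
pose proof (Rmax_l 2 (2 * (64 * A) ^ 2)).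
pose proof (Rmax_r 2 (2 * (64 * A) ^ 2)).
set (q := sqrt (2 + y)). set (s := sqrt q).
assert (hq : 0 < q) by (apply sqrt_lt_R0; lra).
assert (hs : 0 < s) by now apply sqrt_lt_R0.
assert (eq : q * q = 2 + y) by (apply sqrt_sqrt; lra).
assert (es : s * s = q) by (apply sqrt_sqrt; lra).
assert (hl : ln (2 + y) = 4 * ln s).
{ rewrite <- eq, <- es. rewrite !ln_mult by nra. ring. }
assert (0 <= lg (2 + y)) by (apply lg_nonneg; lra).
pose proof (lg_le_twice_ln (2 + y)).
pose proof (ln_le_sub_one s hs).
assert (h8 : lg (2 + y) <= 8 * s) by lra.
apply Rle_trans with (A * (64 * q)).
- apply Rmult_le_compat_l; [lra|]. rewrite <- es. simpl. nra.
- assert (q ^ 2 <= 2 * y) by (simpl; lra).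
  assert ((64 * A) ^ 2 <= y / 2) by lra.
  assert (0 < 64 * A) by lra.
  set (B := 64 * A) in *. replace (A * (64 * q)) with (B * q) by (unfold B; ring).
  simpl in *. assert ((B * q) ^ 2 <= y ^ 2).
  { simpl. replace (B * q * (B * q * 1)) with ((B * (B * 1)) * (q * (q * 1))) by ring.
    replace (y * (y * 1)) with ((y / 2) * (2 * y)) by field.
    apply Rmult_le_compat; nra. }
  simpl in *. nra.
Qed.

(** * The potential of an edge as a function of [H] *)

Definition pot (x : R) : R := x / lg (2 + x) ^ 2.

Lemma lg_2_add_ge_1 (x : R) : 0 <= x -> 1 <= lg (2 + x).
Proof. intros hx. apply lg_ge_1. lra. Qed.

Lemma inv_sq_le (p q : R) : 0 < p -> p <= q -> / q ^ 2 <= / p ^ 2.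
Proof.
intros hp hq. apply Rinv_le_contravar; [now apply pow_lt|].
apply pow_incr. lra.
Qed.

Lemma pot_derive (x : R) : 0 <= x ->
  is_derive pot x
    ((ln (2 + x) - 2 * x / (2 + x)) / ln (2 + x) * / lg (2 + x) ^ 2).
Proof.
intros hx. pose proof ln2_bounds.
pose proof (lg_2_add_ge_1 x hx) as hg. pose proof (ln_lg (2 + x)) as e.
assert (hl : 0 < ln (2 + x)) by (rewrite e; nra).
unfold pot, lg. auto_derive.
- repeat split; try lra. simpl.
  assert (0 < ln (2 + x) * / ln 2)
    by (apply Rmult_lt_0_compat; [lra|apply Rinv_0_lt_compat; lra]). nra.
- field. lra.
Qed.

(** The tangent of [ln] at [4] bounds the numerator of the derivative. *)
Lemma pot_increment (u y : R) : 0 <= u -> 0 <= y ->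
  / 16 * y / lg (2 + (u + y)) ^ 2 <= pot (u + y) - pot u <= y.
Proof.
intros hu hy.
destruct (Rle_lt_or_eq_dec 0 y hy) as [h|<-].
2:{ rewrite Rplus_0_r. split; [apply Req_le; unfold Rdiv; ring|lra]. }
destruct (MVT_cor2 pot
  (fun x => (ln (2 + x) - 2 * x / (2 + x)) / ln (2 + x) * / lg (2 + x) ^ 2)
  u (u + y)) as [c [hc [h1 h2]]]; [lra| |].
{ intros c hc. apply is_derive_Reals, pot_derive. lra. }
replace (u + y - u) with y in hc by ring. rewrite hc. clear hc.
pose proof ln2_bounds as hl2.
assert (hg : 1 <= lg (2 + c)) by (apply lg_2_add_ge_1; lra).
assert (hg2 : lg (2 + c) <= lg (2 + (u + y))) by (apply lg_le; lra).
pose proof (inv_sq_le (lg (2 + c)) (lg (2 + (u + y)))) as hi.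
assert (hi1 : 0 < / lg (2 + (u + y)) ^ 2) by (apply Rinv_0_lt_compat, pow_lt; lra).
pose proof (inv_sq_le 1 (lg (2 + c))) as hi2.
replace (/ 1 ^ 2) with 1 in hi2 by field.
set (l := ln (2 + c)).
assert (hl : 7 / 12 <= l) by (unfold l; rewrite (ln_lg (2 + c)); nra).
assert (htan : ln 4 + 1 - 4 / (2 + c) <= l).
{ unfold l. replace (2 + c) with (4 * ((2 + c) / 4)) at 2 by field.
  rewrite ln_mult by lra.
  pose proof (ln_ge_one_sub_inv ((2 + c) / 4)) as ht.
  replace (/ ((2 + c) / 4)) with (4 / (2 + c)) in ht by (field; lra). lra. }
assert (e4 : ln 4 = 2 * ln 2) by (replace 4 with (2 * 2) by ring; rewrite ln_mult; lra).
assert (hc2 : 0 < / (2 + c)) by (apply Rinv_0_lt_compat; lra).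
assert (ec : 2 * c / (2 + c) = 2 - 4 * / (2 + c)) by (field; lra).
(* The numerator is at least [2 * ln 2 - 1 >= 1 / 6] by the tangent bound, and at least [l - 2];
   averaging these with weights [15 / 16] and [1 / 16] gives more than [l / 16]. *)
assert (hf : / 16 <= (l - 2 * c / (2 + c)) / l <= 1).
{ split.
  - apply Rmult_le_reg_r with l; [lra|]. unfold Rdiv at 1.
    rewrite Rmult_assoc, Rinv_l, Rmult_1_r by lra.
    unfold Rdiv in *. rewrite ec. nra.
  - apply Rmult_le_reg_r with l; [lra|]. unfold Rdiv at 1.
    rewrite Rmult_assoc, Rinv_l, Rmult_1_r by lra.
    assert (0 <= 2 * c / (2 + c)) by (unfold Rdiv; nra). lra. }
set (F := (l - 2 * c / (2 + c)) / l) in *.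
set (I := / lg (2 + c) ^ 2) in *.
set (J := / lg (2 + (u + y)) ^ 2) in *.
assert (J <= I) by (apply hi; lra). assert (I <= 1) by (apply hi2; lra).
unfold Rdiv. fold J.
split.
- replace (/ 16 * y * J) with (/ 16 * J * y) by ring.
  apply Rmult_le_compat_r; [lra|]. nra.
- rewrite <- (Rmult_1_l y) at 2. apply Rmult_le_compat_r; [lra|]. nra.
Qed.

Lemma pot_le (x y : R) : 0 <= x -> x <= y -> pot x <= pot y.
Proof.
intros hx hy. destruct (pot_increment x (y - x)) as [h _]; [lra..|].
replace (x + (y - x)) with y in h by ring.
enough (0 <= / 16 * (y - x) / lg (2 + y) ^ 2) by lra.
apply Rmult_le_pos; [lra|].
left. apply Rinv_0_lt_compat, pow_lt. pose proof (lg_2_add_ge_1 y). lra.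
Qed.

Lemma pot_le_self (x : R) : 0 <= x -> pot x <= x.
Proof.
intros hx. destruct (pot_increment 0 x) as [_ h]; [lra..|].
rewrite Rplus_0_l in h. unfold pot at 2 in h.
unfold Rdiv in h. rewrite Rmult_0_l in h. lra.
Qed.

(** The ratio of [pot x] to [x] decreases: splitting the numerator leaves two terms whose
    denominators are too large. *)
Lemma pot_subadd (x y : R) : 0 <= x -> 0 <= y -> pot (x + y) <= pot x + pot y.
Proof.
intros hx hy. unfold pot, Rdiv. rewrite Rmult_plus_distr_r.
pose proof (lg_2_add_ge_1 x hx). pose proof (lg_2_add_ge_1 y hy).
apply Rplus_le_compat; (apply Rmult_le_compat_l; [easy|]; apply inv_sq_le;
  [lra|apply lg_le; lra]).
Qed.

(** Below [t] monotonicity suffices, above [t] the denominator is at least the one at [t]. The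
    threshold [t] is later tuned to the round. *)
Lemma pot_le_affine (t x : R) : 0 <= t -> 0 <= x ->
  pot x <= (t + x) / lg (2 + t) ^ 2.
Proof.
intros ht hx. pose proof (lg_2_add_ge_1 t ht).
assert (0 < / lg (2 + t) ^ 2) by (apply Rinv_0_lt_compat, pow_lt; lra).
destruct (Rle_lt_dec x t) as [h|h].
- apply Rle_trans with (pot t); [now apply pot_le|]. unfold pot, Rdiv.
  apply Rmult_le_compat_r; lra.
- unfold pot. apply Rmult_le_compat; [lra| |lra|].
  + left. apply Rinv_0_lt_compat, pow_lt. pose proof (lg_2_add_ge_1 x). lra.
  + apply inv_sq_le; [lra|]. apply lg_le; lra.
Qed.


(** * The potential change of one rotation *)

(** The four edges after the rotation minus the four before. [S] is also the size at the new upper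
    node, so the edge above it keeps its value. *)
Definition pair_change (S S' D a b c : R) : R :=
  pot (lg (S / D)) + pot (lg (S / c)) + pot (lg (D / a)) + pot (lg (D / b))
  - pot (lg (S / a)) - pot (lg (S / S')) - pot (lg (S' / b))
  - pot (lg (S' / c)).

(** By subadditivity the old edges to [S'] and [b] are worth at least [pot (lg (S / b))]. As
    [a, b <= D], the old value at the larger of [a] and [b] pays for the new edge to [D]; the value
    at the smaller one is kept as the negative term. *)
Lemma pair_change_le (S S' D a b c : R) :
  1 <= a -> 1 <= b -> 1 <= c ->
  S = 1 + a + S' -> S' = 1 + b + c -> D = 1 + a + b ->
  exists m M : R, 1 <= m <= M /\ D = 1 + m + M /\
    (m = a \/ m = b) /\
    pair_change S S' D a b c <=
      pot (lg (S / c)) + pot (lg (D / m)) + pot (lg (D / M))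
      - pot (lg (S / D) + lg (D / m)).
Proof.
intros ha hb hc eS eS' eD.
assert (h1 : lg (S / S') + lg (S' / b) = lg (S / b)) by (apply lg_div_trans; lra).
assert (h2 : lg (S / S') + lg (S' / c) = lg (S / c)) by (apply lg_div_trans; lra).
assert (h3 : lg (S / D) + lg (D / a) = lg (S / a)) by (apply lg_div_trans; lra).
assert (h4 : lg (S / D) + lg (D / b) = lg (S / b)) by (apply lg_div_trans; lra).
assert (p1 : 0 <= lg (S / S')) by (apply lg_div_nonneg; lra).
assert (p2 : 0 <= lg (S' / b)) by (apply lg_div_nonneg; lra).
assert (p3 : 0 <= lg (S' / c)) by (apply lg_div_nonneg; lra).
assert (p4 : 0 <= lg (S / D)) by (apply lg_div_nonneg; lra).
assert (p5 : 0 <= lg (D / a)) by (apply lg_div_nonneg; lra).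
assert (p6 : 0 <= lg (D / b)) by (apply lg_div_nonneg; lra).
pose proof (pot_subadd _ _ p1 p2) as q1. rewrite h1 in q1.
pose proof (pot_subadd _ _ p1 p3) as q2. rewrite h2 in q2.
assert (q3 : pot (lg (S / S')) <= pot (lg (S / c))) by (apply pot_le; lra).
assert (qa : pot (lg (S / D)) <= pot (lg (S / a))) by (apply pot_le; lra).
assert (qb : pot (lg (S / D)) <= pot (lg (S / b))) by (apply pot_le; lra).
unfold pair_change.
destruct (Rle_lt_dec a b) as [h|h].
- exists a, b. rewrite h3. split; [lra|]. split; [lra|]. split; [now left|]. lra.
- exists b, a. rewrite h4. split; [lra|]. split; [lra|]. split; [now right|]. lra.
Qed.

Lemma pot_larger_part_le_2 (D m M : R) :
  1 <= m <= M -> D = 1 + m + M -> pot (lg (D / M)) <= 2.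
Proof.
intros h e. assert (p : 0 <= lg (D / M)) by (apply lg_div_nonneg; lra).
apply Rle_trans with (lg (D / M)); [now apply pot_le_self|].
replace 2 with (lg 4).
- apply lg_le; [apply Rdiv_lt_0_compat; lra|].
  apply Rmult_le_reg_r with M; [lra|]. unfold Rdiv.
  rewrite Rmult_assoc, Rinv_l; lra.
- replace 4 with (2 * 2) by ring. rewrite lg_mult by lra. rewrite lg_2. ring.
Qed.

(** Put [u = lg (D / m)] and [y = lg (S / D)]. The edge to [M] costs at most [12 * (m / D)],
    exponentially small in [u], while [pot (u + y) - pot u] is of order at least
    [y / lg (2 + u + y) ^ 2]. The exponential absorbs the dependence on [u], and a large [y] absorbs
    [lg (2 + y) ^ 2]. *)
Lemma pair_no_loss : exists Y : R, forall S D m M : R,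
  1 <= m <= M -> D = 1 + m + M -> D <= S -> Y <= lg (S / D) ->
  pot (lg (D / m)) + pot (lg (D / M)) <= pot (lg (S / D) + lg (D / m)).
Proof.
(* [12288 = 12 * 64 * 16], from [hv], from [hsq] and from the factor [/ 16] of [pot_increment]. *)
destruct (lg_sq_sublinear 12288) as [Y [hY1 hY]]; [lra|].
exists Y. intros S D m M hm eD hS hy.
set (y := lg (S / D)) in *. set (u := lg (D / m)).
assert (hu : 0 <= u) by (apply lg_div_nonneg; lra).
assert (hv : pot (lg (D / M)) <= 12 * (m / D)).
{ assert (p : 0 <= lg (D / M)) by (apply lg_div_nonneg; lra).
  apply Rle_trans with (lg (D / M)); [now apply pot_le_self|].
  assert (h1 : 1 <= D / M).
  { apply Rmult_le_reg_r with M; [lra|]. unfold Rdiv.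
    rewrite Rmult_assoc, Rinv_l; lra. }
  pose proof (lg_le_twice_ln _ h1).
  pose proof (ln_le_sub_one (D / M)).
  assert (D / M - 1 <= 6 * (m / D)); [|lra].
  apply Rmult_le_reg_r with (M * D); [nra|].
  replace ((D / M - 1) * (M * D)) with ((D - M) * D) by (field; lra).
  replace (6 * (m / D) * (M * D)) with (6 * m * M) by (field; lra).
  nra. }
assert (hq : m / D * (1 + u / 4) ^ 2 <= 1).
{ assert (e : D / m = exp (u * ln 2 / 2) ^ 2).
  { replace (exp (u * ln 2 / 2) ^ 2) with (exp (u * ln 2 / 2 + u * ln 2 / 2))
      by (rewrite exp_plus; ring).
    replace (u * ln 2 / 2 + u * ln 2 / 2) with (ln (D / m)).
    - rewrite exp_ln; [easy|]. apply Rdiv_lt_0_compat; lra.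
    - rewrite ln_lg. unfold u. field. }
  pose proof (exp_ineq1_le (u * ln 2 / 2)). pose proof ln2_bounds.
  assert ((1 + u / 4) ^ 2 <= D / m) by (rewrite e; apply pow_incr; nra).
  apply Rle_trans with (m / D * (D / m)); [|right; field; lra].
  apply Rmult_le_compat_l; [|easy]. left. apply Rdiv_lt_0_compat; lra. }
set (G := lg (2 + y)).
assert (hG : 1 <= G) by (apply lg_2_add_ge_1; lra).
assert (hlg : lg (2 + (u + y)) <= 8 * G * (1 + u / 4)).
{ apply Rle_trans with (lg ((2 + y) * (1 + u))); [apply lg_le; nra|].
  rewrite lg_mult by lra. fold G.
  pose proof (lg_le_twice_ln (1 + u)). pose proof (ln_le_sub_one (1 + u)).
  nra. }
assert (hlg1 : 1 <= lg (2 + (u + y))) by (apply lg_2_add_ge_1; lra).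
assert (hsq : m / D * lg (2 + (u + y)) ^ 2 <= 64 * G ^ 2).
{ apply Rle_trans with (m / D * (8 * G * (1 + u / 4)) ^ 2).
  - apply Rmult_le_compat_l; [left; apply Rdiv_lt_0_compat; lra|].
    apply pow_incr. lra.
  - replace (m / D * (8 * G * (1 + u / 4)) ^ 2) with
      (64 * G ^ 2 * (m / D * (1 + u / 4) ^ 2)) by ring.
    rewrite <- (Rmult_1_r (64 * G ^ 2)) at 2.
    apply Rmult_le_compat_l; [nra|easy]. }
specialize (hY y hy). fold G in hY.
destruct (pot_increment u y) as [hi _]; [lra..|].
rewrite (Rplus_comm y u).
enough (12 * (m / D) <= / 16 * y / lg (2 + (u + y)) ^ 2) by lra.
assert (hp : 0 < lg (2 + (u + y)) ^ 2) by (apply pow_lt; lra).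
apply Rmult_le_reg_r with (lg (2 + (u + y)) ^ 2); [easy|].
unfold Rdiv at 2. rewrite (Rmult_assoc (/ 16 * y)), Rinv_l by lra. nra.
Qed.

(** For large [lg (S / D)] there is nothing to pay beyond [pot (lg (S / c))]. Otherwise [D] takes a
    constant share of [S], so [lg (S / c)] is bounded below and a multiple of it absorbs the
    additive 2. *)
Lemma pair_change_le_gap : exists C : R, 0 <= C /\ forall S S' D a b c : R,
  1 <= a -> 1 <= b -> 1 <= c ->
  S = 1 + a + S' -> S' = 1 + b + c -> D = 1 + a + b ->
  pair_change S S' D a b c <= C * lg (S / c).
Proof.
destruct pair_no_loss as [Y hY].
pose proof (exp_pos (- Y)) as hpos.
assert (hinv : 0 < / exp (- Y)) by now apply Rinv_0_lt_compat.
exists (2 + 2 * / exp (- Y)). split; [lra|].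
intros S S' D a b c ha hb hc eS eS' eD.
destruct (pair_change_le S S' D a b c) as [m [M [hm [e [_ h]]]]]; try assumption.
assert (p : 0 <= lg (S / c)) by (apply lg_div_nonneg; lra).
pose proof (pot_le_self _ p).
destruct (Rle_lt_dec Y (lg (S / D))) as [hy|hy].
- specialize (hY S D m M hm e). assert (D <= S) by lra. nra.
- pose proof (lg_div_lower_bound S D c Y) as hl.
  assert (hh : exp (- Y) <= lg (S / c)) by (apply hl; lra).
  pose proof (pot_larger_part_le_2 D m M hm e).
  assert (pot (lg (D / m)) <= pot (lg (S / D) + lg (D / m))).
  { assert (0 <= lg (S / D)) by (apply lg_div_nonneg; lra).
    apply pot_le; [apply lg_div_nonneg|]; lra. }
  assert (1 <= / exp (- Y) * lg (S / c)).
  { apply Rle_trans with (/ exp (- Y) * exp (- Y)); [rewrite Rinv_l; lra|].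
    apply Rmult_le_compat_l; lra. }
  lra.
Qed.

(** Keeping [pot] instead of its linear bound pays off when few pairs are left, where the additive 2
    is affordable. *)
Lemma pair_change_le_pot (S S' D a b c : R) :
  1 <= a -> 1 <= b -> 1 <= c ->
  S = 1 + a + S' -> S' = 1 + b + c -> D = 1 + a + b ->
  pair_change S S' D a b c <= pot (lg (S / c)) + 2.
Proof.
intros ha hb hc eS eS' eD.
destruct (pair_change_le S S' D a b c) as [m [M [hm [e [_ h]]]]]; try assumption.
pose proof (pot_larger_part_le_2 D m M hm e).
assert (pot (lg (D / m)) <= pot (lg (S / D) + lg (D / m))).
{ assert (0 <= lg (S / D)) by (apply lg_div_nonneg; lra).
  apply pot_le; [apply lg_div_nonneg|]; lra. }
lra.
Qed.

(** * Credits of path nodes *)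

(** Of the three units, one will cover the losses of the block of rounds that earns them; two remain
    as the gain in [passes_gain]. *)
Definition credit (th x : R) : R := if Rlt_dec th x then 3 else 0.

Lemma credit_bounds (th x : R) : 0 <= credit th x <= 3.
Proof. unfold credit. destruct (Rlt_dec th x); lra. Qed.

(** The floor [M] makes the level constant once the iterated logarithms are small, and covers
    arguments where [ln] takes its default value. *)
Definition level (M z : R) : R := Rmax z M ^ 3.

(** [lg (3 + level M z)] is at most four times the cube root of
    [level M (lg z)], so the cube outgrows the square of the logarithm. *)
Lemma level_step (A : R) : 0 <= A -> exists M : R, 1 <= M /\
  forall z : R, A * lg (3 + level M z) ^ 2 <= level M (lg z).
Proof.
(* [3] ensures [3 + w ^ 3 <= w ^ 4]; [16 * A] absorbs [A * 4 ^ 2]. *)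
intros hA. exists (Rmax 3 (16 * A)). set (M := Rmax 3 (16 * A)).
assert (h3 : 3 <= M) by apply Rmax_l. assert (hM : 16 * A <= M) by apply Rmax_r.
split; [lra|]. intros z. unfold level.
set (w := Rmax z M). set (w' := Rmax (lg z) M).
assert (hw : M <= w) by apply Rmax_r. assert (hw' : M <= w') by apply Rmax_r.
assert (hl : lg w <= w').
{ unfold w, w'. destruct (Rle_lt_dec z M) as [h|h].
  - rewrite (Rmax_right z M) by easy. pose proof (lg_le_self M).
    apply Rle_trans with M; [lra|apply Rmax_r].
  - rewrite (Rmax_left z M) by lra. apply Rmax_l. }
assert (h4 : lg (3 + w ^ 3) <= 4 * w').
{ apply Rle_trans with (lg (w ^ 4)).
  - assert (9 <= w ^ 2) by (simpl; nra). assert (27 <= w ^ 3) by (simpl; nra).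
    apply lg_le; [lra|]. replace (w ^ 4) with (w * w ^ 3) by ring. nra.
  - rewrite lg_pow by lra. simpl INR. lra. }
assert (h0 : 0 <= lg (3 + w ^ 3)).
{ apply lg_nonneg. assert (0 < w ^ 3) by (apply pow_lt; lra). lra. }
assert (h5 : lg (3 + w ^ 3) ^ 2 <= (4 * w') ^ 2) by (apply pow_incr; lra).
apply Rle_trans with (A * (4 * w') ^ 2); [now apply Rmult_le_compat_l|].
replace (A * (4 * w') ^ 2) with (16 * A * w' ^ 2) by ring.
replace (w' ^ 3) with (w' * w' ^ 2) by ring.
apply Rmult_le_compat_r; [apply pow2_ge_0|lra].
Qed.

(** A new credit is paid by an old one, or by the gap term if [lg (S / c) >= 1]. In the remaining
    case [lg (S / D)] exceeds the new level while [a] and [b] are below the old one, and the drop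
    pays. *)
Lemma pair_credit : exists C M : R, 0 <= C /\ 1 <= M /\
  forall z S S' D a b c : R,
  1 <= a -> 1 <= b -> 1 <= c ->
  S = 1 + a + S' -> S' = 1 + b + c -> D = 1 + a + b ->
  pair_change S S' D a b c + credit (level M (lg z)) (lg (S / D)) <=
  credit (level M z) (lg (S / a)) + credit (level M z) (lg (S' / b))
  + C * lg (S / c).
Proof.
destruct pair_change_le_gap as [C0 [hC0 hgap]].
(* [80 = 16 * 5]: the drop has to reach 5, namely 3 for the new credit and 2 for the edge to the
   larger subtree. *)
destruct (level_step 80) as [M [hM hlev]]; [lra|].
exists (C0 + 5), M. split; [lra|]. split; [easy|].
intros z S S' D a b c ha hb hc eS eS' eD.
assert (p : 0 <= lg (S / c)) by (apply lg_div_nonneg; lra).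
pose proof (hgap S S' D a b c) as hg0.
specialize (hg0 ha hb hc eS eS' eD).
pose proof (credit_bounds (level M z) (lg (S / a))).
pose proof (credit_bounds (level M z) (lg (S' / b))).
destruct (Rle_lt_dec 1 (lg (S / c))) as [h1|h1].
{ pose proof (credit_bounds (level M (lg z)) (lg (S / D))). nra. }
unfold credit at 1. destruct (Rlt_dec (level M (lg z)) (lg (S / D))) as [hy|hy].
2:{ nra. }
unfold credit in *.
destruct (Rlt_dec (level M z) (lg (S / a))) as [hxa|hxa]; [nra|].
destruct (Rlt_dec (level M z) (lg (S' / b))) as [hxb|hxb]; [nra|].
destruct (pair_change_le S S' D a b c) as [m [B [hm [e [hmab h]]]]]; try assumption.
pose proof (pot_larger_part_le_2 D m B hm e).
pose proof (pot_le_self _ p).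
assert (py : 0 <= lg (S / D)) by (apply lg_div_nonneg; lra).
assert (pu : 0 <= lg (D / m)) by (apply lg_div_nonneg; lra).
(* Since [lg (S / S') <= lg (S / c) < 1], measuring [b] from [S] instead of [S'] adds at most 1. *)
assert (hu : lg (S / D) + lg (D / m) <= level M z + 1).
{ assert (lg (S / D) + lg (D / m) = lg (S / m)) by (apply lg_div_trans; lra).
  assert (lg (S / S') + lg (S' / b) = lg (S / b)) by (apply lg_div_trans; lra).
  assert (lg (S / S') + lg (S' / c) = lg (S / c)) by (apply lg_div_trans; lra).
  assert (0 <= lg (S' / c)) by (apply lg_div_nonneg; lra).
  destruct hmab; subst m; lra. }
enough (5 + pot (lg (D / m)) <= pot (lg (S / D) + lg (D / m))) by nra.
destruct (pot_increment (lg (D / m)) (lg (S / D))) as [hi _]; [lra..|].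
rewrite (Rplus_comm (lg (S / D))).
rewrite (Rplus_comm (lg (S / D))) in hu.
set (X := lg (D / m) + lg (S / D)) in *.
enough (5 <= / 16 * lg (S / D) / lg (2 + X) ^ 2) by lra.
assert (hX : 1 <= lg (2 + X)) by (apply lg_2_add_ge_1; unfold X; lra).
assert (hXl : lg (2 + X) <= lg (3 + level M z)) by (apply lg_le; unfold X in *; lra).
assert (hX2 : lg (2 + X) ^ 2 <= lg (3 + level M z) ^ 2) by (apply pow_incr; lra).
specialize (hlev z).
assert (hp : 0 < lg (2 + X) ^ 2) by (apply pow_lt; lra).
apply Rmult_le_reg_r with (lg (2 + X) ^ 2); [easy|].
unfold Rdiv at 1. rewrite (Rmult_assoc (/ 16 * _)), Rinv_l by lra. lra.
Qed.


(** * Paths in trees and pairing rounds *)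

Definition opposite (d : side) : side :=
  match d with ToLeft => ToRight | ToRight => ToLeft end.

(** A constructor relative to the path direction, so that both directions share one argument. *)
Definition node (d : side) (off on : bintree) : bintree :=
  match d with ToLeft => Node on off | ToRight => Node off on end.

Lemma node_inv (d : side) (t : bintree) :
  t <> Leaf -> exists off on : bintree, t = node d off on.
Proof.
destruct t as [|l r]; [easy|]. intros _.
destruct d; [now exists r, l | now exists l, r].
Qed.

Lemma child_node (d : side) (u v : bintree) : child d (node d u v) = v.
Proof. now destruct d. Qed.

Lemma child_opposite_node (d : side) (u v : bintree) :
  child (opposite d) (node d u v) = u.
Proof. now destruct d. Qed.

Lemma set_child_node (d : side) (u v v' : bintree) :
  set_child d (node d u v) v' = node d u v'.
Proof. now destruct d. Qed.

Lemma rotate_node (d : side) (A B C : bintree) :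
  rotate d (node d A (node d B C)) = node d (node d A B) C.
Proof. now destruct d. Qed.

Lemma size_node (d : side) (u v : bintree) :
  size (node d u v) = S (size u + size v).
Proof. destruct d; simpl; lia. Qed.

Lemma INR_size_node (d : side) (u v : bintree) :
  INR (size (node d u v)) = 1 + INR (size u) + INR (size v).
Proof. rewrite size_node, S_INR, plus_INR. ring. Qed.

Lemma Phi_node (d : side) (u v : bintree) :
  Phi (node d u v) =
    phi (size (node d u v)) (size u) + phi (size (node d u v)) (size v)
    + Phi u + Phi v.
Proof.
destruct d; simpl; [|ring].
rewrite (Nat.add_comm (size v) (size u)). ring.
Qed.

Lemma size_pos (t : bintree) : (1 <= size t)%nat.
Proof. destruct t; simpl; lia. Qed.

Lemma INR_size_ge_1 (t : bintree) : 1 <= INR (size t).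
Proof. apply (le_INR 1), size_pos. Qed.

Fixpoint spine (d : side) (m : nat) (t : bintree) : Prop :=
  match m with
  | O => True
  | S m' => t <> Leaf /\ spine d m' (child d t)
  end.

Fixpoint descend (d : side) (m : nat) (t : bintree) : bintree :=
  match m with
  | O => t
  | S m' => descend d m' (child d t)
  end.

Fixpoint spine_weight (d : side) (w : R -> R) (m : nat) (t : bintree) : R :=
  match m with
  | O => 0
  | S m' => w (edge_H (size t) (size (child (opposite d) t)))
            + spine_weight d w m' (child d t)
  end.

Lemma spine_add (d : side) (m e : nat) (t : bintree) :
  spine d (m + e) t <-> spine d m t /\ spine d e (descend d m t).
Proof.
revert t; induction m as [|m IH]; intros t; simpl; [tauto|].
rewrite IH. tauto.
Qed.

Lemma spine_weight_add (d : side) (w : R -> R) (m e : nat) (t : bintree) :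
  spine_weight d w (m + e) t =
  spine_weight d w m t + spine_weight d w e (descend d m t).
Proof.
revert t; induction m as [|m IH]; intros t; simpl; [ring|].
rewrite IH. ring.
Qed.

Lemma spine_weight_nonneg (d : side) (w : R -> R) (m : nat) (t : bintree) :
  (forall x : R, 0 <= w x) -> 0 <= spine_weight d w m t.
Proof.
intros hw. revert t; induction m as [|m IH]; intros t; simpl; [lra|].
pose proof (hw (edge_H (size t) (size (child (opposite d) t)))).
specialize (IH (child d t)). lra.
Qed.

Lemma spine_weight_0 (d : side) (m : nat) (t : bintree) :
  spine_weight d (fun _ => 0) m t = 0.
Proof.
revert t; induction m as [|m IH]; intros t; simpl; [|rewrite IH]; ring.
Qed.

Lemma pairing_round_node (d : side) (m : nat) (A B C : bintree) :
  pairing_round d (S m) (node d A (node d B C)) =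
  node d (node d A B) (pairing_round d m C).
Proof.
cbn [pairing_round]. rewrite rotate_node, child_node. apply set_child_node.
Qed.

Lemma spine_SS_inv (d : side) (m : nat) (t : bintree) :
  spine d (2 * S m) t ->
  exists A B C : bintree, t = node d A (node d B C) /\ spine d (2 * m) C.
Proof.
replace (2 * S m)%nat with (S (S (2 * m))) by lia.
intros [h1 [h2 h3]].
destruct (node_inv d t h1) as [A [t1 ->]]. rewrite child_node in h2, h3.
destruct (node_inv d t1 h2) as [B [C ->]]. rewrite child_node in h3.
now exists A, B, C.
Qed.

Lemma pairing_round_spine (d : side) (m : nat) (t : bintree) :
  spine d (2 * m) t ->
  size (pairing_round d m t) = size t /\ spine d m (pairing_round d m t) /\
  descend d m (pairing_round d m t) = descend d (2 * m) t.
Proof.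
revert t; induction m as [|m IH]; intros t; [easy|].
intros h. destruct (spine_SS_inv d m t h) as [A [B [C [-> hC]]]].
destruct (IH C hC) as [h1 [h2 h3]].
rewrite pairing_round_node. split; [|split].
- rewrite !size_node, h1. lia.
- cbn [spine]. rewrite child_node. split; [now destruct d|easy].
- replace (2 * S m)%nat with (S (S (2 * m))) by lia.
  cbn [descend]. now rewrite !child_node.
Qed.

(** Amortized cost of one rotation: [w] and [w'] are the credits on the path
    nodes before and after the round. *)
Definition pair_bound (w w' : R -> R) (al be : R) : Prop :=
  forall S S' D a b c : R,
  1 <= a -> 1 <= b -> 1 <= c ->
  S = 1 + a + S' -> S' = 1 + b + c -> D = 1 + a + b ->
  pair_change S S' D a b c + w' (lg (S / D)) <=
  w (lg (S / a)) + w (lg (S' / b)) + al * lg (S / c) + be.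

(** The rest of the round keeps the size of [C], so each pair is charged independently, and the gaps
    [lg (S / c)] telescope down the path. *)
Lemma pairing_round_Phi (d : side) (w w' : R -> R) (al be : R) (m : nat)
  (t : bintree) :
  pair_bound w w' al be -> spine d (2 * m) t ->
  Phi (pairing_round d m t) + spine_weight d w' m (pairing_round d m t) <=
  Phi t + spine_weight d w (2 * m) t
  + al * lg (INR (size t) / INR (size (descend d (2 * m) t))) + be * INR m.
Proof.
intros hp. revert t; induction m as [|m IH]; intros t h.
- simpl. pose proof (INR_size_ge_1 t).
  replace (INR (size t) / INR (size t)) with 1 by (field; lra).
  replace (lg 1) with 0; [lra|]. unfold lg. rewrite ln_1. unfold Rdiv. ring.
- destruct (spine_SS_inv d m t h) as [A [B [C [-> hC]]]].
  specialize (IH C hC). destruct (pairing_round_spine d m C hC) as [h1 _].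
  rewrite pairing_round_node.
  replace (2 * S m)%nat with (S (S (2 * m))) by lia.
  cbn [spine_weight descend]. rewrite !child_node, !child_opposite_node.
  rewrite !Phi_node.
  set (C' := pairing_round d m C) in *.
  set (E := descend d (2 * m) C) in *.
  set (t0 := node d A (node d B C)).
  assert (e0 : size (node d (node d A B) C') = size t0).
  { unfold t0. rewrite !size_node. rewrite h1. lia. }
  rewrite e0, h1.
  pose proof (INR_size_ge_1 A) as gA. pose proof (INR_size_ge_1 B) as gB.
  pose proof (INR_size_ge_1 C) as gC. pose proof (INR_size_ge_1 E) as gE.
  pose proof (hp (INR (size t0)) (INR (size (node d B C)))
    (INR (size (node d A B))) _ _ _ gA gB gC
    (INR_size_node d _ _) (INR_size_node d _ _) (INR_size_node d _ _)) as hpair.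
  rewrite <- (lg_div_trans (INR (size t0)) (INR (size C)) (INR (size E)));
    [|unfold t0; rewrite !INR_size_node; lra|lra|lra].
  unfold pair_change in hpair. rewrite S_INR.
  unfold phi. fold (pot (edge_H (size t0) (size A))).
  change (fun x => x) with (fun x : R => x).
  unfold pot, edge_H in *. lra.
Qed.

Lemma lg_div_le_lg (x y : R) : 0 < x -> 1 <= y -> lg (x / y) <= lg x.
Proof.
intros hx hy. apply lg_le; [apply Rdiv_lt_0_compat; lra|].
apply Rmult_le_reg_r with y; [lra|]. unfold Rdiv.
rewrite Rmult_assoc, Rinv_l; nra.
Qed.

Lemma INR_pow2 (r : nat) : INR (2 ^ r) = 2 ^ r.
Proof. rewrite pow_INR. reflexivity. Qed.

(** The last of the [2 ^ S r - 1] nodes has no partner; it leaves the tracked path, and its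
    nonnegative credit is dropped. *)
Lemma halving_round (d : side) (w w' : R -> R) (al be : R) (r : nat)
  (t : bintree) :
  pair_bound w w' al be -> 0 <= al -> 0 <= be -> (forall x : R, 0 <= w x) ->
  spine d (2 ^ S r - 1) t ->
  let t' := pairing_round d (2 ^ r - 1) t in
  size t' = size t /\ spine d (2 ^ r - 1) t' /\
  Phi t' + spine_weight d w' (2 ^ r - 1) t' <=
  Phi t + spine_weight d w (2 ^ S r - 1) t
  + al * lg (INR (size t)) + be * 2 ^ r.
Proof.
intros hp hal hbe hw hs.
assert (hpow : (2 ^ r <> 0)%nat) by (apply Nat.pow_nonzero; lia).
set (m := (2 ^ r - 1)%nat).
replace (2 ^ S r - 1)%nat with (2 * m + 1)%nat in * by (simpl; lia).
pose proof hs as hs'. apply spine_add in hs'. destruct hs' as [hs' _].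
destruct (pairing_round_spine d m t hs') as [h1 [h2 _]].
pose proof (pairing_round_Phi d w w' al be m t hp hs') as h3.
intros t'. split; [easy|]. split; [easy|].
rewrite spine_weight_add.
pose proof (spine_weight_nonneg d w 1 (descend d (2 * m) t) hw).
pose proof (lg_div_le_lg (INR (size t)) (INR (size (descend d (2 * m) t)))) as h4.
pose proof (INR_size_ge_1 t). pose proof (INR_size_ge_1 (descend d (2 * m) t)).
assert (INR m <= 2 ^ r) by (rewrite <- INR_pow2; apply le_INR; lia).
fold t' in h3.
apply Rmult_le_compat_l with (r := al) in h4; [|lra..].
assert (be * INR m <= be * 2 ^ r) by (apply Rmult_le_compat_l; lra).
lra.
Qed.

(** The rounds after the first, indexed by the exponent of the tracked length [2 ^ r - 1]. The final
    step performs no rotation. *)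
Fixpoint passes (d : side) (r : nat) (t : bintree) : bintree :=
  match r with
  | O => t
  | S r' => passes d r' (pairing_round d (2 ^ r' - 1) t)
  end.

Lemma passes_size (d : side) (r : nat) (t : bintree) :
  spine d (2 ^ r - 1) t -> size (passes d r t) = size t.
Proof.
revert t; induction r as [|r IH]; intros t h; [easy|].
(* Any valid bound serves, since only the size and spine parts of [halving_round] are used. *)
assert (hp : pair_bound (fun _ => 0) (fun _ => 0) 1 2).
{ intros S S' D a b c. intros. pose proof (pair_change_le_pot S S' D a b c).
  assert (0 <= lg (S / c)) by (apply lg_div_nonneg; lra).
  pose proof (pot_le_self (lg (S / c))). lra. }
destruct (halving_round d _ _ _ _ r t hp) as [h1 [h2 _]]; try (intros; lra); [easy|].
cbn [passes]. rewrite IH by easy. easy.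
Qed.

(** Generalized over the number [s] of rounds already done. [passes] takes one step more than the
    list, the one without rotations. *)
Lemma fold_left_passes (d : side) (j r s : nat) (t : bintree) :
  j = (s + r + 1)%nat ->
  fold_left (fun u i => pairing_round d (2 ^ (j - i + 1) - 1) u)
    (seq (2 + s) r) t = passes d (S r) t.
Proof.
revert s t; induction r as [|r IH]; intros s t e; [easy|].
change (seq (2 + s) (S r)) with ((2 + s)%nat :: seq (2 + S s) r).
cbn [fold_left]. rewrite IH by lia.
replace (j - (2 + s) + 1)%nat with (S r) by lia. easy.
Qed.

Lemma multipass_passes (d : side) (k : nat) (t : bintree) : (1 <= k)%nat ->
  multipass d k t = passes d (top_exp k) (pairing_round d (alpha k) t).
Proof.
intros hk. unfold multipass.
assert (1 <= top_exp k)%nat by (unfold top_exp; apply Nat.log2_le_pow2; simpl; lia).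
change 2%nat with (2 + 0)%nat at 2.
rewrite (fold_left_passes d (top_exp k) (top_exp k - 1) 0) by lia.
f_equal. lia.
Qed.

Lemma spine_monotone_path (d : side) (k : nat) (t : bintree) :
  (1 <= k)%nat -> subtree t (repeat d (k - 1)) <> Leaf -> spine d k t.
Proof.
intros hk. destruct k as [|k]; [lia|]. clear hk.
replace (S k - 1)%nat with k by lia.
revert t; induction k as [|k IH]; intros t h; [now split|].
split; [|now apply IH].
intros ->. apply h. clear. cbn [repeat subtree child].
induction k; [easy|]. exact IHk.
Qed.

Lemma subtree_app (t : bintree) (a b : list side) :
  subtree t (a ++ b) = subtree (subtree t a) b.
Proof. revert t; induction a; intros t; simpl; easy. Qed.

Lemma subtree_Leaf (a : list side) : subtree Leaf a = Leaf.
Proof. induction a; easy. Qed.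

(** As the size of the replaced subtree is kept, no edge outside it changes its value. *)
Lemma replace_at_spec (T : bintree) (a : list side) (u : bintree) :
  subtree T a <> Leaf -> size u = size (subtree T a) ->
  size (replace_at T a u) = size T /\
  Phi (replace_at T a u) - Phi T = Phi u - Phi (subtree T a).
Proof.
revert T; induction a as [|d a IH]; intros T h e; [easy|].
cbn [subtree replace_at] in *.
destruct T as [|l r]; [now rewrite subtree_Leaf in h|].
destruct (node_inv d (Node l r)) as [off [on eT]]; [easy|]. rewrite eT in *.
rewrite child_node in *. rewrite set_child_node.
destruct (IH on h e) as [h1 h2].
split; [rewrite !size_node; lia|].
rewrite !Phi_node, !size_node, h1. lra.
Qed.


(** * Credits along a path and through a block of rounds *)

(** A node without credit has a large off-path child, so its path child is smaller by a constant
    factor; charging it 3 units against that gap telescopes. *)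
Lemma spine_credit_ge (d : side) (th : R) (m : nat) (t : bintree) :
  spine d m t ->
  3 * INR m - 3 * / exp (- th) * lg (INR (size t) / INR (size (descend d m t)))
  <= spine_weight d (credit th) m t.
Proof.
assert (hpos : 0 < / exp (- th)) by apply Rinv_0_lt_compat, exp_pos.
revert t; induction m as [|m IH]; intros t.
- intros _. simpl. pose proof (INR_size_ge_1 t).
  assert (0 <= lg (INR (size t) / INR (size t))) by (apply lg_div_nonneg; lra).
  nra.
- intros [h1 h2]. destruct (node_inv d t h1) as [A [C ->]].
  rewrite child_node in h2. specialize (IH C h2).
  cbn [spine_weight descend]. rewrite child_node, child_opposite_node.
  set (E := descend d m C) in *.
  pose proof (INR_size_ge_1 A). pose proof (INR_size_ge_1 C).
  pose proof (INR_size_ge_1 E).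
  pose proof (INR_size_node d A C) as e.
  rewrite <- (lg_div_trans _ (INR (size C))) by lra.
  rewrite S_INR.
  set (S := INR (size (node d A C))) in *.
  assert (0 <= lg (S / INR (size C))) by (apply lg_div_nonneg; lra).
  assert (3 <= credit th (edge_H (size (node d A C)) (size A))
    + 3 * / exp (- th) * lg (S / INR (size C))).
  { unfold credit, edge_H. fold S.
    destruct (Rlt_dec th (lg (S / INR (size A)))) as [h|h]; [nra|].
    pose proof (lg_div_lower_bound S (INR (size A)) (INR (size C)) th) as hl.
    assert (hh : exp (- th) <= lg (S / INR (size C))) by (apply hl; lra).
    apply Rmult_le_compat_l with (r := / exp (- th)) in hh; [|lra].
    pose proof (exp_pos (- th)). rewrite Rinv_l in hh; lra. }
  lra.
Qed.

Lemma spine_credit_0 (d : side) (th : R) (m : nat) (t : bintree) :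
  spine d m t -> lg (INR (size t)) <= th -> spine_weight d (credit th) m t = 0.
Proof.
revert t; induction m as [|m IH]; intros t; [easy|].
intros [h1 h2] hth. destruct (node_inv d t h1) as [A [C ->]].
cbn [spine_weight]. rewrite child_node, child_opposite_node in *.
pose proof (INR_size_ge_1 A). pose proof (INR_size_ge_1 C).
pose proof (INR_size_node d A C) as e.
rewrite IH; [|easy|].
- unfold credit, edge_H.
  destruct (Rlt_dec th _) as [h|h]; [|ring].
  pose proof (lg_div_le_lg (INR (size (node d A C))) (INR (size A))). lra.
- apply Rle_trans with (lg (INR (size (node d A C)))); [apply lg_le|]; lra.
Qed.

(** The credits after one round are those before the next, so they cancel and only the first and
    last levels remain. *)
Lemma passes_block (C M : R) : 0 <= C ->
  (forall z : R,
    pair_bound (credit (level M z)) (credit (level M (lg z))) C 0) ->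
  forall (d : side) (i r : nat) (z : R) (t : bintree),
  spine d (2 ^ (i + r) - 1) t ->
  exists t' : bintree, passes d (i + r) t = passes d r t' /\
    size t' = size t /\ spine d (2 ^ r - 1) t' /\
    Phi t' + spine_weight d (credit (level M (lg_iter i z))) (2 ^ r - 1) t' <=
    Phi t + spine_weight d (credit (level M z)) (2 ^ (i + r) - 1) t
    + C * lg (INR (size t)) * INR i.
Proof.
intros hC hp d i. induction i as [|i IH]; intros r z t h.
- exists t. simpl. simpl in h. repeat split; try easy. lra.
- destruct (halving_round d _ _ _ _ (i + r) t (hp z)) as [h1 [h2 h3]];
    try easy; try lra; [intros x; apply credit_bounds|].
  destruct (IH r (lg z) _ h2) as [t' [k1 [k2 [k3 k4]]]].
  exists t'. split; [exact k1|]. split; [congruence|]. split; [easy|].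
  rewrite h1 in k4. rewrite S_INR. cbn [lg_iter Nat.add].
  cbn [Nat.add] in h3. lra.
Qed.

(** * Losses of rounds without credits *)

Lemma pair_bound_gap : exists C : R, 0 <= C /\
  pair_bound (fun _ => 0) (fun _ => 0) C 0.
Proof.
destruct pair_change_le_gap as [C [hC hgap]]. exists C. split; [easy|].
intros S S' D a b c. intros. pose proof (hgap S S' D a b c). lra.
Qed.

(** Trades the coefficient of the telescoping gap against a fixed cost per pair: the fewer the
    pairs, the larger [t] may be. *)
Lemma pair_bound_affine (t : R) : 0 <= t ->
  pair_bound (fun _ => 0) (fun _ => 0)
    (/ lg (2 + t) ^ 2) (2 + t * / lg (2 + t) ^ 2).
Proof.
intros ht S S' D a b c. intros.
pose proof (pair_change_le_pot S S' D a b c).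
assert (0 <= lg (S / c)) by (apply lg_div_nonneg; lra).
set (x := lg (S / c)) in *.
pose proof (pot_le_affine t x ht) as h.
unfold Rdiv in h. rewrite Rmult_plus_distr_r in h. lra.
Qed.

(** The right side is a telescoping majorant of [4 / (q + 1) ^ 2], which makes the losses of
    successive rounds summable by induction. *)
Lemma inv_lg_sq_le (q : nat) :
  / lg (2 + 2 ^ q) ^ 2 <= 8 * (/ (INR q + 1) - / (INR q + 2)).
Proof.
pose proof (pos_INR q) as hq.
assert (hp : 0 < 2 ^ q) by (apply pow_lt; lra).
assert (h1 : 1 <= lg (2 + 2 ^ q)) by (apply lg_2_add_ge_1; lra).
assert (h2 : INR q <= lg (2 + 2 ^ q)).
{ apply Rle_trans with (lg (2 ^ q)); [|apply lg_le; lra].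
  rewrite lg_pow, lg_2; lra. }
apply Rle_trans with (/ ((INR q + 1) / 2) ^ 2); [apply inv_sq_le; lra|].
set (x := INR q) in *.
replace (/ ((x + 1) / 2) ^ 2) with (4 * (/ (x + 1) * / (x + 1))) by (field; lra).
replace (8 * (/ (x + 1) - / (x + 2))) with (4 * (/ (x + 1) * (2 * / (x + 2))))
  by (field; lra).
apply Rmult_le_compat_l; [lra|].
apply Rmult_le_compat_l; [left; apply Rinv_0_lt_compat; lra|].
replace (/ (x + 1)) with (2 * / (2 * (x + 1))) by (field; lra).
apply Rmult_le_compat_l; [lra|]. apply Rinv_le_contravar; lra.
Qed.

(** Once at most [2 * lg n] path nodes are left, the losses of the rounds are
    summable; the exponent 2 in [phi] is what makes the series converge. *)
Lemma passes_short (d : side) (R0 r : nat) (t : bintree) :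
  2 ^ R0 <= lg (INR (size t)) -> (r <= R0 + 1)%nat -> spine d (2 ^ r - 1) t ->
  Phi (passes d r t) <=
  Phi t + 2 * 2 ^ r + 8 * lg (INR (size t)) * (2 * / INR (R0 + 2 - r)).
Proof.
revert t; induction r as [|r IH]; intros t hR hr h.
- simpl. pose proof (pow_lt 2 R0).
  assert (0 < / INR (R0 + 2 - 0)) by (apply Rinv_0_lt_compat, lt_0_INR; lia).
  nra.
(* With threshold [2 ^ q], the [2 ^ r] pairs cost [2 ^ R0 * I <= L * I] besides their constant 2, no
   more than the gap term. *)
- set (q := (R0 - r)%nat).
  assert (hq2 : 0 < 2 ^ q) by (apply pow_lt; lra).
  pose proof (pair_bound_affine (2 ^ q)) as hp.
  assert (h1 : 1 <= lg (2 + 2 ^ q)) by (apply lg_2_add_ge_1; lra).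
  assert (hi : 0 < / lg (2 + 2 ^ q) ^ 2) by (apply Rinv_0_lt_compat, pow_lt; lra).
  pose proof (inv_lg_sq_le q) as hs.
  set (I := / lg (2 + 2 ^ q) ^ 2) in *.
  destruct (halving_round d (fun _ => 0) (fun _ => 0) I (2 + 2 ^ q * I) r t)
    as [k1 [k2 k3]]; [apply hp; lra|lra|nra|intros; lra|easy|].
  rewrite !spine_weight_0 in k3.
  set (t' := pairing_round d (2 ^ r - 1) t) in *.
  specialize (IH t'). rewrite k1 in IH. specialize (IH hR ltac:(lia) k2).
  cbn [passes]. fold t'.
  assert (e : 2 ^ q * 2 ^ r = 2 ^ R0) by (rewrite <- pow_add; f_equal; lia).
  replace (INR (R0 + 2 - r)) with (INR q + 2) in IH
    by (replace (R0 + 2 - r)%nat with (q + 2)%nat by lia;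
      rewrite plus_INR; simpl; ring).
  replace (INR (R0 + 2 - S r)) with (INR q + 1)
    by (replace (R0 + 2 - S r)%nat with (q + 1)%nat by lia;
      rewrite plus_INR; simpl; ring).
  set (L := lg (INR (size t)) ) in *.
  assert (hk : (2 + 2 ^ q * I) * 2 ^ r <= 2 * 2 ^ r + L * I).
  { replace ((2 + 2 ^ q * I) * 2 ^ r) with (2 * 2 ^ r + 2 ^ q * 2 ^ r * I) by ring.
    rewrite e. apply Rplus_le_compat_l, Rmult_le_compat_r; lra. }
  assert (hL : 0 < L) by (pose proof (pow_lt 2 R0); lra).
  apply Rmult_le_compat_l with (r := L) in hs; [|lra].
  change (2 ^ S r) with (2 * 2 ^ r). lra.
Qed.

Lemma passes_loss (C : R) : 0 <= C ->
  pair_bound (fun _ => 0) (fun _ => 0) C 0 ->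
  forall (d : side) (R0 r : nat) (t : bintree),
  2 ^ R0 <= lg (INR (size t)) -> spine d (2 ^ r - 1) t ->
  Phi (passes d r t) <=
  Phi t + (20 + C * INR (r - (R0 + 1))) * lg (INR (size t)).
Proof.
intros hC hp d R0 r t hR. revert t hR.
induction r as [|r IH]; intros t hR h.
all: pose proof (pow_lt 2 R0 ltac:(lra)) as hR0.
- simpl. lra.
- destruct (le_lt_dec (S r) (R0 + 1)) as [hr|hr].
  (* The constant 20 is [4 + 16]: [2 * 2 ^ S r] is at most four times [lg n], the series at most
     sixteen times. *)
  + replace (S r - (R0 + 1))%nat with 0%nat by lia.
    pose proof (passes_short d R0 (S r) t hR hr h) as k.
    assert (2 ^ S r <= 2 * 2 ^ R0).
    { change (2 * 2 ^ R0) with (2 ^ S R0). apply Rle_pow; [lra|lia]. }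
    assert (hb : 1 <= INR (R0 + 2 - S r)) by (apply (le_INR 1); lia).
    apply Rinv_le_contravar in hb; [|lra]. rewrite Rinv_1 in hb.
    simpl INR. nra.
  + destruct (halving_round d _ _ _ _ r t hp) as [k1 [k2 k3]];
      [lra|lra|intros; lra|easy|].
    rewrite !spine_weight_0 in k3. cbn [passes].
    set (t' := pairing_round d (2 ^ r - 1) t) in *.
    specialize (IH t'). rewrite k1 in IH. specialize (IH hR k2).
    replace (S r - (R0 + 1))%nat with (S (r - (R0 + 1))) by lia.
    rewrite S_INR. lra.
Qed.

(** * Balancing gains against losses *)

Lemma pow2_bracket (x : R) : 1 <= x -> exists m : nat, 2 ^ m <= x < 2 ^ S m.
Proof.
intros hx. destruct (Pow_x_infinity 2) with (b := x) as [N hN].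
{ rewrite Rabs_right; lra. }
assert (hb : x < 2 ^ S N).
{ specialize (hN N (le_n N)). pose proof (pow_lt 2 N).
  rewrite Rabs_right in hN by lra. simpl. lra. }
clear hN. induction N as [|N IH].
- exists 0%nat. simpl in *. lra.
- destruct (Rlt_le_dec x (2 ^ S N)) as [h|h]; [now apply IH|].
  now exists (S N).
Qed.

Lemma log_star_pos (n : nat) : (2 <= n)%nat -> (1 <= log_star n)%nat.
Proof.
intros hn. destruct (log_star_spec n) as [h _]; [lia|].
destruct (log_star n); [|lia]. simpl in h. apply le_INR in hn. simpl in hn. lra.
Qed.

(** Strong induction in blocks of [log_star n] rounds. A block that leaves a long path pays for
    itself by its credits and supplies the whole negative term, so the additive term of the
    induction hypothesis is inherited without growing. *)
Lemma passes_gain : exists C : R, 0 <= C /\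
  forall (d : side) (r : nat) (t : bintree),
  let n := size t in (2 <= n)%nat ->
  spine d (2 ^ r - 1) t ->
  Phi (passes d r t) <=
  Phi t + C * lg (INR n) * INR (log_star n) - 2 * (2 ^ r / 2 ^ log_star n).
Proof.
destruct pair_bound_gap as [C0 [hC0 hp0]].
destruct pair_credit as [C1 [M [hC1 [hM hcredit]]]].
assert (hp1 : forall z : R,
  pair_bound (credit (level M z)) (credit (level M (lg z))) C1 0).
{ intros z S S' D a b c. intros. rewrite Rplus_0_r. now apply hcredit. }
set (th := M ^ 3).
assert (hth : 0 < / exp (- th)) by apply Rinv_0_lt_compat, exp_pos.
(* The summands cover the losses of a block, the nodes without credit, and the 1 in [2 ^ r' - 1]. *)
set (C3 := C1 + 3 * / exp (- th) + 3).
assert (hC3 : 1 <= C3) by (unfold C3; lra).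
destruct (pow2_bracket C3 hC3) as [c [_ hc]].
(* Designed for short paths: the loss from [passes_loss], plus [2 * C3] to offset the claimed
   gain. *)
set (C2 := 20 + C0 * (INR (S c) + 2) + 2 * C3).
pose proof (pos_INR (S c)) as hcpos.
exists C2. split; [unfold C2; nra|].
intros d r. induction r as [r IH] using (well_founded_induction Wf_nat.lt_wf).
intros t n hn h. unfold n in *.
set (Lam := lg (INR (size t))) in *. set (L := log_star (size t)) in *.
assert (hL : (1 <= L)%nat) by now apply log_star_pos.
assert (hLR : 1 <= INR L) by now apply (le_INR 1).
assert (hLam : 1 <= Lam).
{ unfold Lam. apply lg_ge_1. apply (le_INR 2) in hn. simpl in hn. lra. }
assert (hLL : Lam <= Lam * INR L) by nra.
assert (hpow : 0 < 2 ^ L) by (apply pow_lt; lra).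
destruct (pow2_bracket Lam hLam) as [R0 [hR1 hR2]].
pose proof (passes_loss C0 hC0 hp0 d R0 r t hR1 h) as hloss. fold Lam in hloss.
(* A path of length [O (lg n * L * 2 ^ L)] has only [O (L)] rounds before the
   losses become summable. *)
assert (hshort : (r <= R0 + 2 * L + S c + 1)%nat -> 2 ^ r / 2 ^ L <= C3 * Lam * INR L ->
  Phi (passes d r t) <= Phi t + C2 * Lam * INR L - 2 * (2 ^ r / 2 ^ L)).
{ intros hr1 hr2.
  assert (hb : INR (r - (R0 + 1)) <= (INR (S c) + 2) * INR L).
  { apply Rle_trans with (INR (2 * L + S c)); [apply le_INR; lia|].
    rewrite plus_INR, mult_INR. simpl (INR 2). nra. }
  apply Rmult_le_compat_l with (r := C0 * Lam) in hb; [|nra].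
  unfold C2. nra. }
destruct (le_lt_dec L r) as [hr|hr].
2:{ apply hshort; [lia|]. apply Rle_trans with 1; [|nra].
  apply Rmult_le_reg_r with (2 ^ L); [easy|]. unfold Rdiv.
  rewrite Rmult_assoc, Rinv_l by lra.
  rewrite Rmult_1_l, Rmult_1_r. apply Rle_pow; [lra|lia]. }
set (r' := (r - L)%nat).
assert (er : r = (L + r')%nat) by (unfold r'; lia).
assert (e2 : 2 ^ r / 2 ^ L = 2 ^ r') by (rewrite er, pow_add; field; lra).
destruct (Rle_lt_dec (C3 * Lam * INR L) (2 ^ r')) as [hlong|hlong].
(* The factors are below [2 ^ S c], below [2 ^ S R0] and at most [2 ^ L], which bounds the exponent
   [r']. *)
2:{ apply hshort; [|lra].
  assert (hLp : INR L <= 2 ^ L).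
  { rewrite <- INR_pow2. apply le_INR, Nat.lt_le_incl, Nat.pow_gt_lin_r. lia. }
  assert (2 ^ r' < 2 ^ (S c + (S R0 + L))).
  { rewrite !pow_add. apply Rlt_le_trans with (1 := hlong).
    rewrite Rmult_assoc. apply Rmult_le_compat; nra. }
  enough (r' < S c + (S R0 + L))%nat by lia.
  apply Nat.nle_gt. intros hle. apply (Rle_pow 2) in hle; lra. }
rewrite e2. rewrite er in h.
destruct (passes_block C1 M hC1 hp1 d L r' (INR (size t)) t h)
  as [t' [k1 [k2 [k3 k4]]]].
destruct (log_star_spec (size t)) as [hstar _]; [lia|].
fold L in hstar.
(* After [L] iterated logarithms the value is at most [1 <= M], so the floor is reached. *)
assert (elev : level M (lg_iter L (INR (size t))) = th).
{ unfold level. now rewrite Rmax_right by lra. }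
rewrite elev in k4.
rewrite (spine_credit_0 d (level M (INR (size t)))) in k4; [|easy|].
2:{ apply Rle_trans with (INR (size t));
    [apply lg_le_self, INR_size_ge_1|].
  unfold level. pose proof (Rmax_l (INR (size t)) M).
  pose proof (Rmax_r (INR (size t)) M).
  set (w := Rmax (INR (size t)) M) in *.
  assert (1 <= w ^ 2) by (apply pow_R1_Rle; lra).
  replace (w ^ 3) with (w * w ^ 2) by ring. nra. }
pose proof (spine_credit_ge d th _ t' k3) as k5.
assert (k6 : lg (INR (size t') / INR (size (descend d (2 ^ r' - 1) t'))) <= Lam).
{ rewrite k2. apply lg_div_le_lg; [|apply INR_size_ge_1].
  pose proof (INR_size_ge_1 t). lra. }
apply Rmult_le_compat_l with (r := / exp (- th)) in k6; [|lra].
rewrite minus_INR, INR_pow2 in k5.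
2:{ assert (2 ^ r' <> 0)%nat by (apply Nat.pow_nonzero; lia). lia. }
simpl (INR 1) in k5.
specialize (IH r' ltac:(lia) t'). rewrite k2 in IH. cbv zeta in IH.
specialize (IH hn k3). fold Lam L in IH.
rewrite er, k1. fold Lam in k4.
assert (0 < 2 ^ r' / 2 ^ L) by (apply Rdiv_lt_0_compat; [apply pow_lt|]; lra).
assert (/ exp (- th) * Lam <= / exp (- th) * (Lam * INR L)) by (apply Rmult_le_compat_l; lra).
unfold C3 in hlong. lra.
Qed.

Theorem theorem16 :
  exists C : R,
  forall (T : bintree) (d : side) (a : list side) (k : nat),
    monotone_path T d a k ->
    let n := size (subtree T a) in
    Phi (replace_at T a (multipass d k (subtree T a))) - Phi T
      <= - (INR k / 2 ^ log_star n) + C * lg (INR n) * INR (log_star n).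
Proof.
destruct pair_bound_gap as [C0 [hC0 hp0]].
destruct passes_gain as [C1 [hC1 hgain]].
exists (C0 + C1). intros T d a k [hk hpath] n.
rewrite subtree_app in hpath. unfold n. set (t := subtree T a) in *.
pose proof (spine_monotone_path d k t hk hpath) as hs.
assert (ht : t <> Leaf) by (destruct k; [lia|]; apply hs).
assert (hn : (2 <= size t)%nat).
{ destruct t as [|l r]; [easy|]. cbn [size].
  pose proof (size_pos l). lia. }
destruct (first_round_spec k) as [[hal1 hal2] _].
assert (hj : (k + 1 < 2 * 2 ^ top_exp k)%nat).
{ unfold top_exp. apply Nat.log2_spec. lia. }
(* [k + 1 < 2 * 2 ^ top_exp k] gives [2 * alpha k <= k]: the first round stays within the path. *)
assert (hs2 : exists e, k = (2 * alpha k + e)%nat).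
{ exists (k - 2 * alpha k)%nat. lia. }
destruct hs2 as [e he].
assert (hs3 : spine d (2 * alpha k) t /\ spine d e (descend d (2 * alpha k) t))
  by (apply spine_add; now rewrite <- he).
destruct hs3 as [hs3 hs4].
destruct (pairing_round_spine d (alpha k) t hs3) as [h1 [h2 h3]].
pose proof (pairing_round_Phi d _ _ _ _ (alpha k) t hp0 hs3) as h4.
rewrite !spine_weight_0 in h4.
set (t' := pairing_round d (alpha k) t) in *.
(* The [alpha k] survivors of the pairs followed by the [e] unpaired nodes. *)
assert (hst' : spine d (2 ^ top_exp k - 1) t').
{ rewrite <- hal2. replace (k - alpha k)%nat with (alpha k + e)%nat by lia.
  apply spine_add. rewrite h3. now split. }
pose proof (hgain d (top_exp k) t') as h5. cbv zeta in h5. rewrite h1 in h5.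
specialize (h5 hn hst').
rewrite multipass_passes by easy. fold t'.
destruct (replace_at_spec T a (passes d (top_exp k) t')) as [_ hrep].
{ exact ht. }
{ rewrite passes_size by easy. exact h1. }
rewrite hrep. fold t.
pose proof (lg_div_le_lg (INR (size t)) (INR (size (descend d (2 * alpha k) t)))) as h6.
pose proof (INR_size_ge_1 t). pose proof (INR_size_ge_1 (descend d (2 * alpha k) t)).
apply Rmult_le_compat_l with (r := C0) in h6; [|lra..].
assert (hL : 1 <= INR (log_star (size t))) by now apply (le_INR 1), log_star_pos.
assert (hlam : 0 <= lg (INR (size t))) by now apply lg_nonneg.
assert (h7 : C0 * lg (INR (size t)) * 1 <= C0 * lg (INR (size t)) * INR (log_star (size t)))
  by (apply Rmult_le_compat_l; nra).
(* Here the factor 2 in the gain of [passes_gain] is spent. *)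
assert (hk2 : INR k <= 2 * 2 ^ top_exp k).
{ rewrite <- INR_pow2. replace 2 with (INR 2) by (simpl; ring).
  rewrite <- mult_INR. apply le_INR. lia. }
assert (hpow : 0 < / 2 ^ log_star (size t)) by (apply Rinv_0_lt_compat, pow_lt; lra).
apply Rmult_le_compat_r with (r := / 2 ^ log_star (size t)) in hk2; [|lra].
unfold Rdiv in *. lra.
Qed.
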